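(* Let $d$ be a constant and let $\mathsf{Ext}:\{0,1\}^n\times\{0,1\}^{l}\to\{0,1\}^m$, with $l=\mathrm{poly}(n)$, be a strong $(k,\epsilon)$-extractor with $k=n-1$ which can be computed by $\mathsf{AC}^0$ circuits of depth $d$. Then $\epsilon\ge 1/2^{O(\log^d n)}$.
   Context: A random variable $X$ on $\{0,1\}^n$ is an $(n,k)$-source if $\Pr[X=x]\le 2^{-k}$ for every $x$ (min-entropy at least $k$). The statistical distance is $\mathsf{SD}(X,Y)=\frac12\sum_a|\Pr[X=a]-\Pr[Y=a]|$. A function $\mathsf{Ext}:\{0,1\}^n\times\{0,1\}^d\to\{0,1\}^m$ is a strong $(k,\epsilon)$-extractor if for every $(n,k)$-source $X$ and $U$ uniform on $\{0,1\}^d$ independent of $X$, $\mathsf{SD}(U\circ\mathsf{Ext}(X,U),U_{d+m})\le\epsilon$, where $\circ$ is concatenation and $U_{d+m}$ is uniform. $\mathsf{AC}^0$ circuits are families of circuits of polynomial size (in $n$) and constant depth with NOT gates and unbounded fan-in AND/OR gates. Asymptotic notation is with respect to $n\to\infty$. *)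

(* Defs.v *)
From HB Require Import structures.
From mathcomp Require Export all_boot all_order all_algebra.
From mathcomp Require Export all_classical all_reals all_analysis.

Set Implicit Arguments.
Unset Strict Implicit.
Unset Printing Implicit Defensive.

Import Order.TTheory GRing.Theory Num.Theory.
Local Open Scope ring_scope.

(* Random variables with finite range are represented by their probability
   mass functions T -> R. *)
Section Distributions.
Variable R : realType.

Definition is_pmf (T : finType) (p : T -> R) : Prop :=
  (forall x, 0 <= p x) /\ \sum_x p x = 1.

Definition uniform_pmf (T : finType) : T -> R := fun=> #|T|%:R^-1.

Definition indep_pmf (S T : finType) (p : S -> R) (q : T -> R) : S * T -> R :=
  fun z => p z.1 * q z.2.

Definition map_pmf (S T : finType) (f : S -> T) (p : S -> R) : T -> R :=
  fun y => \sum_(x | f x == y) p x.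

Definition SD (T : finType) (p q : T -> R) : R :=
  2^-1 * \sum_a `|p a - q a|.

Definition is_source (n : nat) (k : R) (X : n.-tuple bool -> R) : Prop :=
  is_pmf X /\ forall x, X x <= 2 `^ (- k).

Definition strong_extractor (n l m : nat) (k eps : R)
    (Ext : n.-tuple bool -> l.-tuple bool -> m.-tuple bool) : Prop :=
  forall X : n.-tuple bool -> R, is_source k X ->
    SD (map_pmf (fun xu => cat_tuple xu.2 (Ext xu.1 xu.2))
          (indep_pmf X (@uniform_pmf (l.-tuple bool))))
       (@uniform_pmf ((l + m).-tuple bool)) <= eps.

Definition log2 (x : R) : R := ln x / ln 2.

End Distributions.

Local Open Scope nat_scope.

(* Circuits are straight-line programs. In a circuit with N inputs, wires
   0, ..., N - 1 carry the inputs and wire N + i carries the output of gate i,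
   which may only read wires of smaller index; fan-out is unrestricted. *)
Inductive gate : Type :=
  | GNot of nat
  | GAnd of seq nat
  | GOr of seq nat.

Definition fanin (g : gate) : seq nat :=
  match g with GNot i => [:: i] | GAnd s => s | GOr s => s end.

Record circuit (N m : nat) : Type := Circuit {
  gates : seq gate;
  outputs : m.-tuple nat;
  gates_wf : forall i, i < size gates ->
    {in fanin (nth (GNot 0) gates i), forall j, j < N + i};
  outputs_wf : {in outputs, forall j, j < N + size gates}
}.

Definition gate_val (v : seq bool) (g : gate) : bool :=
  match g with
  | GNot i => ~~ nth false v i
  | GAnd s => all (nth false v) s
  | GOr s => has (nth false v) s
  end.

(* Only AND and OR gates count towards depth. *)
Definition gate_depth (v : seq nat) (g : gate) : nat :=
  match g with
  | GNot i => nth 0 v i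
  | GAnd s | GOr s => (\max_(i <- s) nth 0 v i).+1
  end.

Section Circuits.
Variables N m : nat.
Implicit Type C : circuit N m.

Definition circuit_eval C (x : N.-tuple bool) : m.-tuple bool :=
  map_tuple
    (nth false (foldl (fun v g => rcons v (gate_val v g)) x (gates C)))
    (outputs C).

Definition circuit_size C : nat := size (gates C).

Definition circuit_depth C : nat :=
  \max_(j <- outputs C)
    nth 0 (foldl (fun v g => rcons v (gate_depth v g)) (nseq N 0) (gates C)) j.

End Circuits.

Definition poly_bounded (f : nat -> nat) : Prop :=
  exists c, forall n, f n <= n ^ c + c.

Definition computed_by_AC0 (d : nat) (l m : nat -> nat)
    (Ext : forall n, n.-tuple bool -> (l n).-tuple bool -> (m n).-tuple bool)
    : Prop :=
  exists C : forall n, circuit (n + l n) (m n),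
    [/\ poly_bounded (fun n => circuit_size (C n)),
        forall n, circuit_depth (C n) <= d
      & forall n x u, circuit_eval (C n) (cat_tuple x u) = Ext n x u].

(* Main.v *)
(* Fix a seed [u]; the first output bit of [Ext] is then a function of [x]
   computed by a polynomial-size circuit of depth [d].  Random restrictions and
   Hastad's switching lemma (in Razborov's encoding form) bound its total
   influence by O(log^(d-1) n), so by Parseval at least half of its Fourier
   weight sits on sets of size t = O(log^(d-1) n).  On the other hand, the
   uniform source and the uniform sources on the points of even parity over S
   have min-entropy at least n - 1, which forces the average over [u] of
   the S-th Fourier coefficient to be at most 4 eps in absolute value.  As there
   are only n^O(t) = 2^O(log^d n) sets of size at most t, eps cannot be smaller
   than 2^-O(log^d n).  In depth 0 the output bit is itself a signed parity over
   a set that does not depend on [u]. *)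

Require Import Defs.
From mathcomp Require Import fintype finset lra zify ring.

Set Implicit Arguments.
Unset Strict Implicit.
Unset Printing Implicit Defensive.

Import Order.TTheory GRing.Theory Num.Theory.
Local Open Scope ring_scope.

(** * Boolean functions on the cube, restrictions and certificates *)

Section Cube.
Variable I : finType.
Implicit Types (A B K S V a x y z : {set I}) (f : {set I} -> bool) (b c : bool).

(** Points of the cube are encoded as subsets of [I], a coordinate being 1 when it belongs to the
    set. *)
Definition agree A x y := x :&: A == y :&: A.

Definition mix K x z := (x :&: K) :|: (z :\: K).

Definition flip (i : I) x := [set j | (j \in x) (+) (j == i)].

Definition restrict f K z : {set I} -> bool := fun x => f (mix K x z).

(** Bounded certificate complexity on the value [b]: for [b = true], [f] is a DNF of width [w]; for
    [b = false], a CNF of width [w]. *)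
Definition certified b w f := forall x, f x = b ->
  exists2 A : {set I}, (#|A| <= w)%N & forall y, agree A x y -> f y = b.

Lemma agreeP A x y :
  reflect (forall i, i \in A -> (i \in x) = (i \in y)) (agree A x y).
Proof.
apply: (iffP eqP) => [e i iA | e].
  by have /setP/(_ i) := e; rewrite !inE iA !andbT.
by apply/setP => i; rewrite !inE; case iA: (i \in A); rewrite ?andbF // !andbT e.
Qed.

Lemma in_mix K x z i : (i \in mix K x z) = if i \in K then i \in x else i \in z.
Proof. by rewrite !inE; case: (i \in K); rewrite /= ?andbT ?andbF ?orbF. Qed.

Lemma flipK i : involutive (flip i).
Proof. by move=> x; apply/setP => j; rewrite !inE -addbA addbb addbF. Qed.

Lemma certified_neg b w f : certified b w f -> certified (~~ b) w (negb \o f).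
Proof.
move=> h x /= /negb_inj /h[A hA hy]; exists A => // y /hy ->.
by [].
Qed.

Lemma eq_certified b w f g : f =1 g -> certified b w f -> certified b w g.
Proof.
by move=> e h x; rewrite -e => /h[A hA hy]; exists A => // y /hy; rewrite e.
Qed.

Lemma certified_le b w w' f :
  (w <= w')%N -> certified b w f -> certified b w' f.
Proof. by move=> le h x /h[A hA hy]; exists A => //; apply: leq_trans le. Qed.

Lemma certified_restrict b w f K z :
  certified b w f -> certified b w (restrict f K z).
Proof.
move=> h x /h[A hA hy]; exists A => // y /agreeP exy; apply: hy.
by apply/agreeP => i iA; rewrite !in_mix exy.
Qed.

Lemma certified_literal b f i :
  (forall x y, (i \in x) = (i \in y) -> f x = f y) -> certified b 1 f.
Proof.
move=> h x fx; exists [set i]; first by rewrite cards1.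
by move=> y /agreeP e; rewrite -fx; apply/esym/h/e; rewrite inE.
Qed.

(** Every sensitive coordinate of [x] lies in its certificate, since flipping any other one keeps
    the certificate valid. *)
Lemma sensitivity_certified b w f x : certified b w f -> f x = b ->
  (\sum_i (f x != f (flip i x)) <= w)%N.
Proof.
move=> h fx; have [A hA hy] := h _ fx.
rewrite (leq_trans _ hA) // -sum1_card [leqRHS]big_mkcond /=.
apply: leq_sum => i _; case: ifPn => iA; first by case: (_ != _).
rewrite fx hy ?eqxx //; apply/agreeP => j jA; rewrite inE.
by case: eqP jA iA => [-> ->|_ _ _]; rewrite ?addbF.
Qed.

End Cube.

(** * Total influence and its behaviour under random restrictions *)

Section Influence.
Variables (R : realFieldType) (I : finType).
Implicit Types (A B K S V a x y z : {set I}) (f : {set I} -> bool) (b c : bool).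

Definition avg (g : {set I} -> R) : R := (\sum_x g x) / (2 ^ #|I|)%:R.

Definition influence f : R := avg (fun x => (\sum_i (f x != f (flip i x)))%:R).

(** The probability that [K] is the set of free variables when each variable is left free
    independently with probability [p]. *)
Definition weight (p : R) K : R := \prod_i (if i \in K then p else 1 - p).

Lemma card_cube : #|{set I}| = (2 ^ #|I|)%N.
Proof. by have := card_powerset [set: I]; rewrite powersetT !cardsT. Qed.

Lemma cube_gt0 : 0 < (2 ^ #|I|)%:R :> R.
Proof. by rewrite ltr0n expn_gt0. Qed.

Lemma cube_neq0 : (2 ^ #|I|)%:R != 0 :> R.
Proof. by rewrite gt_eqF // cube_gt0. Qed.

Lemma avg_const (c : R) : avg (fun=> c) = c.
Proof. by rewrite /avg sumr_const card_cube -[c *+ _]mulr_natr mulfK // cube_neq0. Qed.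

Lemma le_avg (g h : {set I} -> R) : (forall x, g x <= h x) -> avg g <= avg h.
Proof. by move=> le; rewrite ler_wpM2r ?invr_ge0 ?ler0n // ler_sum. Qed.

Lemma avgD (g h : {set I} -> R) : avg (fun x => g x + h x) = avg g + avg h.
Proof. by rewrite /avg big_split mulrDl. Qed.

Lemma avgZ (c : R) (g : {set I} -> R) : avg (fun x => c * g x) = c * avg g.
Proof. by rewrite /avg -mulr_sumr mulrA. Qed.

Lemma avg_flip i (g : {set I} -> R) : avg (g \o flip i) = avg g.
Proof.
by rewrite /avg [in RHS](reindex_inj (can_inj (@flipK I i))).
Qed.

Lemma avg_sum (J : finType) (g : J -> {set I} -> R) :
  avg (fun x => \sum_j g j x) = \sum_j avg (g j).
Proof. by rewrite /avg exchange_big mulr_suml. Qed.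

(** Exchanging the coordinates outside [K] between [x] and [z] is an involution on pairs. *)
Lemma avg_mix K (g : {set I} -> R) :
  avg (fun z => avg (fun x => g (mix K x z))) = avg g.
Proof.
rewrite -[RHS]avg_const /avg; congr (_ / _).
rewrite -mulr_suml -[RHS]mulr_suml; congr (_ / _).
rewrite !pair_big /=.
pose h (q : {set I} * {set I}) := (mix K q.1 q.2, mix K q.2 q.1).
have hK : involutive h.
  case=> x z; rewrite /h /=.
  by congr (_, _); apply/setP => i; rewrite !in_mix; case: (i \in K).
rewrite (reindex_inj (can_inj hK)) /=; apply: eq_bigr => -[x z] _ /=.
by congr g; apply/setP => i; rewrite !in_mix; case: (i \in K).
Qed.

Lemma influence_le_card f : influence f <= #|I|%:R.
Proof.
rewrite -[leRHS]avg_const; apply: le_avg => x; rewrite ler_nat -sum1_card.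
by apply: leq_sum => i _; case: (_ != _).
Qed.

(* Each sensitive edge has exactly one endpoint where [f] takes the value [b]. *)
Lemma influence_certified b w f : certified b w f -> influence f <= (2 * w)%:R.
Proof.
move=> h.
pose g i x := ((f x == b) && (f x != f (flip i x)))%:R : R.
have -> : influence f = \sum_i (avg (g i) + avg (g i)).
  rewrite /influence; under [RHS]eq_bigr => i _ do
    rewrite -{2}(avg_flip i) -avgD.
  rewrite -avg_sum /avg; congr (_ / _); apply: eq_bigr => x _.
  rewrite natr_sum; apply: eq_bigr => i _; rewrite /g /= flipK -natrD.
  by case: (f x) (f (flip i x)) b {h g} => -[] [].
rewrite big_split /= -avg_sum natrM mulr_natl mulr2n.
have le : avg (fun x => \sum_i g i x) <= w%:R; last by rewrite lerD.
rewrite -[leRHS]avg_const; apply: le_avg => x; rewrite /g -natr_sum ler_nat.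
have [/eqP fx|_] := boolP (f x == b); last by rewrite /= big1.
exact: sensitivity_certified h fx.
Qed.

Lemma weight_ge0 p K : 0 <= p -> p <= 1 -> 0 <= weight p K.
Proof. by move=> p0 p1; apply: prodr_ge0 => i _; case: ifP; lra. Qed.

Lemma sum_weight p : \sum_K weight p K = 1.
Proof.
rewrite -(bigA_distr 1 +%R (fun _ : I => p) (fun=> 1 - p)).
by rewrite big1 // => i _ /=; rewrite addrC subrK.
Qed.

(** Replacing the factor [1 - p] at [i] by 0 absorbs the indicator into the product, and the
    distributive law applies. *)
Lemma sum_weight_in p (i : I) : \sum_(K : {set I}) (i \in K)%:R * weight p K = p.
Proof.
pose G j := if j == i then 0 else 1 - p.
transitivity (\sum_(K in {set I}) \prod_j (if j \in K then p else G j)).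
  apply: eq_bigr => K _; rewrite /weight (bigD1 i) //= [in RHS](bigD1 i) //=.
  rewrite {1}/G eqxx; case: (i \in K); rewrite ?mul0r //= mul1r.
  by congr (_ * _); apply: eq_bigr => j ji; rewrite /G (negbTE ji).
rewrite -(bigA_distr 1 +%R (fun _ : I => p) G) (bigD1 i) //= /G eqxx addr0.
by rewrite big1 ?mulr1 // => j ji; rewrite /= (negbTE ji) addrC subrK.
Qed.

(** A sensitive edge in direction [i] survives exactly when [i] is free, which has probability
    [p]. *)
Lemma influence_restrict p f :
  \sum_K weight p K * avg (fun z => influence (restrict f K z))
    = p * influence f.
Proof.
have E K : avg (fun z => influence (restrict f K z)) =
    \sum_i (i \in K)%:R * avg (fun x => (f x != f (flip i x))%:R).
  pose g x := \sum_i (i \in K)%:R * (f x != f (flip i x))%:R : R.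
  transitivity (avg g); last first.
    by rewrite /g avg_sum; apply: eq_bigr => i _; rewrite avgZ.
  rewrite -[RHS](avg_mix K); congr (avg _); apply: funext => z.
  congr (avg _); apply: funext => x; rewrite natr_sum.
  apply: eq_bigr => i _; rewrite /restrict.
  case: (boolP (i \in K)) => iK; rewrite ?mul1r ?mul0r.
    congr ((f _ != f _)%:R); apply/setP => j; rewrite !(in_mix, inE).
    by case: ifP => // jK; case: eqP jK => [->|]; rewrite ?iK ?addbF.
  suff -> : mix K (flip i x) z = mix K x z by rewrite eqxx.
  apply/setP => j; rewrite !in_mix inE; case: ifP => // jK.
  by case: eqP jK iK => [-> ->|_ _ _]; rewrite ?addbF.
under eq_bigr => K _ do rewrite E mulr_sumr.
rewrite exchange_big /= /influence.
under eq_bigr => i _ do (under eq_bigr => K _ do rewrite mulrCA mulrA;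
  rewrite -mulr_suml sum_weight_in).
rewrite -mulr_sumr -avg_sum; congr (_ * avg _); apply: funext => x.
by rewrite natr_sum.
Qed.

End Influence.

(** * Elementary search and counting facts *)

(** Serves to show that encoding a restriction does not change which term is the first consistent
    one. *)
Lemma find_sub (T : Type) (x0 : T) (P Q : pred T) (s : seq T) :
  (forall t, Q t -> P t) -> has P s -> Q (nth x0 s (find P s)) ->
  find Q s = find P s.
Proof.
move=> QP; elim: s => //= t s IH.
case Pt: (P t) => /=; first by move=> _ ->.
by move=> hs Qs; case Qt: (Q t); [rewrite QP in Pt | rewrite IH].
Qed.

Lemma leq_card_bigcup (J T : finType) (P : pred J) (F : J -> {set T}) :
  (#|\bigcup_(j | P j) F j| <= \sum_(j | P j) #|F j|)%N.
Proof.
elim/big_ind2: _ => [|A a B b hA hB|//]; first by rewrite cards0.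
by apply: leq_trans (leq_add hA hB); rewrite cardsU leq_subr.
Qed.

Lemma leq_bin_expn n k : ('C(n, k) <= n ^ k)%N.
Proof.
elim: k n => [|k IH] [|n]; rewrite ?bin0 ?bin0n //.
have := mul_bin_diag n.+1 k; rewrite expnS => e.
have : (k.+1 * 'C(n.+1, k.+1) <= n.+1 * n.+1 ^ k)%N.
  rewrite -e leq_mul2l /= (leq_trans (IH n)) //.
  by case: (k) => // j; rewrite leq_exp2r.
by apply: leq_trans; rewrite leq_pmull.
Qed.

(** * The switching lemma *)

(* Razborov's encoding.  [L] lists the terms of a DNF: the pair [(V, a)] stands
   for the subcube of the points agreeing with [a] on [V].  A restriction is a
   pair [(K, z)]: the variables in [K] are free, the others are fixed as in [z].
   [walk r (K, z) (K', z')] walks down the canonical decision tree, answering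
   [x] to the queries, until [r] variables have been queried; [z'] satisfies
   the terms met on the way instead of following the answers. *)
Section Walk.
Variables (I : finType) (L : seq ({set I} * {set I})).
Implicit Types (K V a x y z B : {set I}) (c T : {set I} * {set I}).

Definition consistent c T := agree (T.1 :\: c.1) T.2 c.2.

Definition first_term c := nth (set0, set0) L (find (consistent c) L).

Inductive walk : nat -> {set I} * {set I} -> {set I} * {set I} -> Prop :=
| walk_nil c : walk 0 c c
| walk_step r K z c' x B : has (consistent (K, z)) L ->
    B = (first_term (K, z)).1 :&: K -> B != set0 ->
    walk r (K :\: B, mix B x z) c' ->
    walk (#|B| + r) (K, z) (c'.1, mix B (first_term (K, z)).2 c'.2).

Lemma walk_inv r c c' : walk r c c' -> (r = 0%N /\ c = c') \/
  exists s K z c1 x B,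
    [/\ c = (K, z), has (consistent (K, z)) L /\ B != set0,
        B = (first_term (K, z)).1 :&: K /\ walk s (K :\: B, mix B x z) c1,
        r = (#|B| + s)%N & c' = (c1.1, mix B (first_term (K, z)).2 c1.2)].
Proof.
case=> [|s K z c1 x B hL eB hB hp]; first by left.
by right; exists s, K, z, c1, x, B.
Qed.

Lemma walk_facts r c c' : walk r c c' ->
  [/\ c'.1 \subset c.1, #|c.1| = (#|c'.1| + r)%N
    & forall i, i \notin c.1 -> (i \in c'.2) = (i \in c.2)].
Proof.
elim=> {r c c'} [c|r K z c' x B _ eB _ _ [/= s e h]]; first by rewrite addn0.
have BK : B \subset K by rewrite eB subsetIr.
split=> /= [||i iK].
- by apply: (subset_trans s); rewrite subsetDl.
- by rewrite addnCA -e -(cardsID B K) (setIidPr BK).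
- have iB : i \notin B by apply: contra iK; apply: (subsetP BK).
  by rewrite in_mix (negbTE iB) h ?in_mix ?(negbTE iB) // inE (negbTE iK) andbF.
Qed.

(* The first term consistent with the encoded restriction is the term that was
   met, so a walk can be replayed backwards from its end. *)
Lemma walk_decode r K z c' x B : has (consistent (K, z)) L ->
    B = (first_term (K, z)).1 :&: K ->
    walk r (K :\: B, mix B x z) c' ->
  let T := first_term (K, z) in
  first_term (c'.1, mix B T.2 c'.2) = T /\ 
  c'.2 = mix B x (mix B T.2 c'.2).
Proof.
move=> hL eB hp T; have [/= s _ h] := walk_facts hp.
have BK i : i \in B -> i \in K by rewrite eB inE => /andP[].
have hB i : i \in B -> (i \in c'.2) = (i \in x).
  by move=> iB; rewrite h ?in_mix ?iB // !inE iB.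
have hK i : i \notin K -> (i \in c'.2) = (i \in z).
  move=> iK; have iB : i \notin B by apply: contra iK => /BK.
  by rewrite h ?in_mix ?(negbTE iB) // !inE (negbTE iK) andbF.
split; last first.
  by apply/setP => i; rewrite !in_mix; case: ifPn => [/hB|/negbTE ->].
rewrite /T /first_term; congr nth; apply: (@find_sub _ (set0, set0)) => //.
  (* Outside [K] the encoded point still equals [z], so a term consistent with the encoding was
     already consistent with [(K, z)]. *)
  move=> U /agreeP hU; apply/agreeP => i /=; rewrite inE => /andP[iK iU].
  rewrite hU /= ?in_mix.
    by case: ifP => [/BK|_]; rewrite ?(negbTE iK) // hK.
  by rewrite inE iU andbT; apply: contra iK => /(subsetP s); rewrite inE => /andP[].
(* The term itself stays consistent: the encoding copies it on [B], and its remaining variables were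
   fixed in its favour by [z]. *)
have := nth_find (set0, set0) hL; rewrite -/(first_term (K, z)) -/T.
move=> /agreeP hT; apply/agreeP => i /=; rewrite inE => /andP[iK iT].
rewrite in_mix; case: ifPn => // iB.
have iK' : i \notin K by move: iB; rewrite eB inE -/T iT.
by rewrite hT ?inE ?iK' //= hK.
Qed.

Variable w : nat.
Hypothesis width : forall T, T \in L -> (#|T.1| <= w)%N.

(** For length [r.+1], decoding recovers the start from [c'], the first queried set [B] of size
    [b.+1] inside the first term of [c'], the answers and the old values on [B], and a walk of
    length [r - b]. The choices number at most [w ^ b.+1], [4 ^ b.+1] and, by induction,
    [(8 * w) ^ (r - b)]. *)
Lemma card_walk r c' : (#|[set c | `[< walk r c c' >]]| <= (8 * w) ^ r)%N.
Proof.
elim/ltn_ind: r c' => -[|r] IH c'.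
  rewrite expn0 -(cards1 c'); apply/subset_leq_card/subsetP => c; rewrite !inE.
  move=> /asboolP /walk_inv[[_ ->] //|[s [K [z [c1 [x [B [_ [_ hB] _ e _]]]]]]]].
  by move: hB; rewrite -card_gt0; lia.
pose V := (first_term c').1.
(* Undoes one step of the walk: frees [B] again and restores the values [y] on it. *)
pose g B y c : {set I} * {set I} := (c.1 :|: B, mix B y c.2).
pose P b := [set B : {set I} | B \subset V & #|B| == b.+1].
pose D b B x y := [set g B y c | c in
    [set c | `[< walk (r - b) c (c'.1, mix B x c'.2) >]]].
have sub : [set c | `[< walk r.+1 c c' >]] \subset
    \bigcup_(b < r.+1) \bigcup_(B in P b) \bigcup_(x in powerset B)
      \bigcup_(y in powerset B) D b B x y.
  apply/subsetP => c; rewrite inE => /asboolP.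
  move=> /walk_inv[[]//|[s [K [z [c1 [x [B [-> [hL hB] [eB hp] e ec]]]]]]]].
  have [e1 e2] := walk_decode hL eB hp; rewrite -ec in e1.
  have Blt : (#|B|.-1 < r.+1)%N by move: hB; rewrite -cards_eq0 => ?; lia.
  have BK : B \subset K by rewrite eB subsetIr.
  apply/bigcupP; exists (Ordinal Blt) => //=.
  apply/bigcupP; exists B.
    by rewrite inE /V e1 {1}eB subsetIl /= prednK // card_gt0.
  apply/bigcupP; exists (x :&: B); first by rewrite powersetE subsetIr.
  apply/bigcupP; exists (z :&: B); first by rewrite powersetE subsetIr.
  apply/imsetP; exists (K :\: B, mix B x z).
    rewrite inE; apply/asboolP => /=.
    have -> : (r - #|B|.-1 = s)%N.
      by move: hB; rewrite -cards_eq0 => ?; lia.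
    suff -> : (c'.1, mix B (x :&: B) c'.2) = c1 by [].
    rewrite ec [RHS]surjective_pairing [in RHS]e2; congr (_, _).
    by apply/setP => i; rewrite /= !in_mix inE; case: (i \in B); rewrite ?andbT.
  rewrite /g /=; congr (_, _); apply/setP => i.
    rewrite !inE; case iB: (i \in B); rewrite ?orbF ?orbT //=.
    by rewrite (subsetP BK).
  by rewrite !in_mix inE; case: (i \in B); rewrite ?andbT.
apply: leq_trans (subset_leq_card sub) _.
have Vw : (#|V| <= w)%N.
  (* Without a consistent term, [first_term] is the default [(set0, set0)], whose width is 0. *)
  rewrite /V /first_term; have [hL|hL] := boolP (has (consistent c') L).
    by apply/width/mem_nth; rewrite -has_find.
  by rewrite (hasNfind hL) nth_default // cards0.
apply: leq_trans (_ : \sum_(b < r.+1) w ^ b.+1 * (4 ^ b.+1 * (8 * w) ^ (r - b)) <= _)%N.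
  apply: leq_trans (leq_card_bigcup _ _) _; apply: leq_sum => b _.
  apply: leq_trans (leq_card_bigcup _ _) _.
  apply: leq_trans (_ : \sum_(B in P b) 4 ^ b.+1 * (8 * w) ^ (r - b) <= _)%N.
    apply: leq_sum => B; rewrite inE => /andP[_ /eqP Bb].
    rewrite (_ : 4 = 2 * 2)%N // expnMn -mulnA -Bb -!card_powerset.
    apply: leq_trans (leq_card_bigcup _ _) _; rewrite -sum_nat_const.
    apply: leq_sum => x _.
    apply: leq_trans (leq_card_bigcup _ _) _; rewrite -sum_nat_const.
    apply: leq_sum => y _.
    by apply: leq_trans (leq_imset_card _ _) _; apply: IH; lia.
  rewrite sum_nat_const leq_mul2r cards_draws.
  by rewrite (leq_trans (leq_bin_expn _ _)) ?orbT // leq_exp2r.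
(* Splitting [8 * w] as [4 * w * 2] leaves a geometric sum below [2 ^ r.+1]. *)
rewrite (_ : \sum_(b < r.+1) _ = (4 * w) ^ r.+1 * \sum_(b < r.+1) 2 ^ (r - b))%N.
  rewrite (reindex_inj rev_ord_inj) /=.
  under eq_bigr => b _ do rewrite subSS (subKn (leq_ord b)).
  rewrite (_ : 8 * w = 4 * w * 2)%N; last lia.
  rewrite (expnMn (4 * w) 2) leq_mul2l; apply/orP; right.
  have -> : (\sum_(b < r.+1) 2 ^ b)%N = (2 ^ r.+1).-1.
    by rewrite predn_exp mul1n.
  exact: leq_pred.
rewrite big_distrr /=; apply: eq_bigr => b _.
rewrite mulnA -expnMn (mulnC w) (_ : 8 * w = 4 * w * 2)%N; last lia.
by rewrite (expnMn (4 * w)) mulnA -expnD; congr (_ ^ _ * _)%N; have := ltn_ord b; lia.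
Qed.

End Walk.

Section Switching.
Variables (R : realFieldType) (I : finType).
Implicit Types (A B K x y z : {set I}) (f : {set I} -> bool) (b : bool).

(** Answering the queries by [x] down to a leaf, the queried variables certify the value false: at
    the leaf no term is consistent any more. *)
Lemma walk_certificate (L : seq ({set I} * {set I})) f :
  (forall x, f x = has (fun T => agree T.1 T.2 x) L) ->
  forall K z x, agree (~: K) z x -> f x = false ->
  exists r c' (A : {set I}), [/\ walk L r (K, z) c', (#|A| <= r)%N
    & forall y, agree (~: K) z y -> agree A x y -> f y = false].
Proof.
move=> fE K z x; move: {2}#|K| (leqnn #|K|) => n.
elim: n K z => [|n IH] K z Kn /agreeP zx fx.
  exists 0%N, (K, z), set0; split; first exact: walk_nil.
    by rewrite cards0.
  move: Kn; rewrite leqn0 cards_eq0 => /eqP K0 y /agreeP zy _; rewrite -fx.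
  by congr f; apply/setP => i; rewrite -zx -?zy // K0 !inE.
have [hL|hL] := boolP (has (consistent (K, z)) L); last first.
  exists 0%N, (K, z), set0; split; first exact: walk_nil.
    by rewrite cards0.
  move=> y /agreeP zy _; apply: contraNF hL; rewrite fE => /hasP[T TL /agreeP Ty].
  apply/hasP; exists T => //; apply/agreeP => i; rewrite inE => /andP[iK iT] /=.
  by rewrite Ty // zy // inE.
have := nth_find (set0, set0) hL; rewrite -/(first_term L (K, z)).
set T := first_term _ _ => /agreeP hT.
pose B := T.1 :&: K.
have TL : T \in L by rewrite mem_nth // -has_find.
(* A consistent term without free variables would be satisfied by [x]. *)
have B0 : B != set0.
  apply: contraFneq fx => B0; rewrite fE; apply/hasP; exists T => //.
  apply/agreeP => i iT.
  have iK : i \notin K.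
    by apply/negP => iK; have := in_set0 i; rewrite -B0 inE iT iK.
  by rewrite hT ?zx ?inE ?iK.
have [||r [c' [A [hp Ar hA]]]] := IH (K :\: B) (mix B x z) _ _ fx.
- rewrite -ltnS (leq_trans _ Kn) // -(cardsID B K) (setIidPr (subsetIr _ _)).
  by rewrite -addn1 addnC leq_add2r card_gt0.
- apply/agreeP => i; rewrite in_mix; case: ifPn => // iB.
  by rewrite in_setC in_setD iB /= => iK; rewrite zx // inE.
exists (#|B| + r)%N, (c'.1, mix B T.2 c'.2), (B :|: A); split.
- exact: walk_step hL _ B0 hp.
- by rewrite cardsU (leq_trans (leq_subr _ _)) // leq_add2l.
move=> y /agreeP zy /agreeP xy; apply: hA; last first.
  by apply/agreeP => i iA; rewrite xy // inE iA orbT.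
apply/agreeP => i; rewrite in_mix; case: ifPn => [iB _|iB].
  by rewrite xy // inE iB.
by rewrite in_setC in_setD iB /= => iK; rewrite zy // inE.
Qed.

(** [L] lists all certificates of width [w] as terms. A point without a certificate of size [s]
    forces a walk longer than [s]; its excess is indexed by ['I_#|I|] because no variable is queried
    twice. *)
Lemma uncertified_walk w s f : certified true w f ->
  exists2 L : seq ({set I} * {set I}), (forall T, T \in L -> (#|T.1| <= w)%N)
    & forall K z, ~ certified false s (restrict f K z) ->
      exists (k : 'I_#|I|) c', walk L (s + k.+1) (K, z) c'.
Proof.
move=> fw.
pose P := [pred T : {set I} * {set I} |
  (#|T.1| <= w)%N && [forall y, agree T.1 T.2 y ==> f y]].
have fE x : f x = has (fun T => agree T.1 T.2 x) (enum P).
  apply/idP/hasP => [fx|[T]].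
    have [A Aw hA] := fw _ fx; exists (A, x); last by rewrite /agree /=.
    by rewrite mem_enum inE /= Aw; apply/forallP => y; apply/implyP => /hA.
  by rewrite mem_enum => /andP[_ /forallP/(_ x)/implyP].
exists (enum P) => [T|K z]; first by rewrite mem_enum => /andP[].
apply: contra_notP => nowalk x fx.
have [|r [c' [A [hp Ar hA]]]] := walk_certificate fE _ fx (K := K) (z := z).
  by apply/agreeP => i; rewrite in_mix inE => /negbTE ->.
exists A; last first.
  move=> y /agreeP xy; apply: hA; apply/agreeP => i; rewrite !in_mix.
    by rewrite inE => /negbTE ->.
  by move=> iA; rewrite xy.
apply: leq_trans Ar _; rewrite leqNgt; apply/negP => sr; apply: nowalk.
have [/= _ e _] := walk_facts hp; have Kn : (#|K| <= #|I|)%N := max_card _.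
have kn : (r - s.+1 < #|I|)%N by lia.
exists (Ordinal kn), c'; rewrite (_ : s + (Ordinal kn).+1 = r)%N //=; lia.
Qed.

(** Fixing [r] free variables trades [r] factors [p] for [1 - p]. *)
Lemma weight_walk p K K' r : #|K| = (#|K'| + r)%N ->
  weight p K * (1 - p) ^+ r = p ^+ r * weight p K' :> R.
Proof.
have E S : weight p S = p ^+ #|S| * (1 - p) ^+ #|~: S| :> R.
  rewrite /weight (bigID (fun i => i \in S)) /=.
  under eq_bigr => i iS do rewrite iS.
  under [X in _ * X]eq_bigr => i iS do rewrite (negbTE iS).
  rewrite prodr_const prodr_const; congr (_ * _ ^+ _).
  by apply: eq_card => i; rewrite !inE.
move=> e; rewrite !E e exprD -!mulrA mulrCA; congr (_ * (_ * _)).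
rewrite -exprD; congr (_ ^+ _).
by have := cardsC K; have := cardsC K'; lia.
Qed.

(* [p / (1 - p) = 1 / (16 w)]: each queried variable then costs half of what the
   [8 w] choices in [card_walk] gain. *)
Definition free_prob (w : nat) : R := (1 + 16 * w)%:R^-1.

Lemma free_prob_gt0 w : 0 < free_prob w.
Proof. by rewrite invr_gt0 ltr0n. Qed.

Lemma free_prob_le1 w : free_prob w <= 1.
Proof. by rewrite invf_le1 ?ltr0n // ler1n. Qed.

Lemma sum_half_tail s n : \sum_(k < n) 2^-1 ^+ (s + k.+1) <= 2^-1 ^+ s :> R.
Proof.
suff -> : \sum_(k < n) 2^-1 ^+ (s + k.+1) = 2^-1 ^+ s - 2^-1 ^+ (s + n) :> R.
  by rewrite gerBl exprn_ge0.
elim: n => [|n IH]; first by rewrite big_ord0 addn0 subrr.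
by rewrite big_ord_recr /= IH addnS exprS; field.
Qed.

(** Union bound over walks. A start weighs [(p / (1 - p)) ^+ r] times the end of its walk, at most
    [(8 * w) ^ r] starts share an end, and the product is [2^-1 ^+ r]; the lengths [r > s] then form
    a geometric tail. *)
Lemma switching_true w s f : (0 < w)%N -> certified true w f ->
  \sum_K weight (free_prob w) K *
    avg (fun z => (~~ `[< certified false s (restrict f K z) >])%:R)
  <= 2^-1 ^+ s :> R.
Proof.
move=> w0 /(@uncertified_walk _ s)[L width hL].
set p := free_prob w; have p0 : 0 < p := free_prob_gt0 w.
have w1 : (1 : R) <= w%:R by rewrite ler1n.
have pE : p * (1 + 16 * w%:R) = 1.
  by rewrite /p /free_prob -natrM -(natrD _ 1 (16 * w)) mulVf // pnatr_eq0.
have p1 : 0 < 1 - p by nra.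
have p1n : 1 - p != 0 by rewrite gt_eqF.
have ratio : p / (1 - p) * (8 * w)%:R = 2^-1.
  rewrite natrM; apply: (mulIf p1n).
  by rewrite mulrAC divfK ?gt_eqF //; nra.
have step (c c' : {set I} * {set I}) r : walk L r c c' ->
    weight p c.1 = (p / (1 - p)) ^+ r * weight p c'.1.
  move=> /walk_facts[_ e _]; have := weight_walk p e.
  rewrite expr_div_n => h; apply: (mulIf (expf_neq0 r p1n)).
  by rewrite h [RHS]mulrAC divfK // expf_neq0.
under eq_bigr => K _ do rewrite /avg mulrA.
rewrite -mulr_suml ler_pdivrMr ?cube_gt0 //.
under eq_bigr => K _ do rewrite mulr_sumr.
rewrite pair_big /=.
pose pth k (c c' : {set I} * {set I}) := `[< walk L (s + k.+1) c c' >].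
apply: (@le_trans _ _ (\sum_(k < #|I|) \sum_(c' : {set I} * {set I})
    \sum_(c : {set I} * {set I})    (pth k c c')%:R * weight p c.1)).
  under [leRHS]eq_bigr => k _ do rewrite exchange_big /=.
  rewrite [leRHS]exchange_big /=; apply: ler_sum => -[K z] _ /=.
  under [leRHS]eq_bigr => k _ do rewrite -mulr_suml.
  rewrite -mulr_suml mulrC ler_wpM2r ?weight_ge0 ?free_prob_le1 ?(ltW p0) //.
  case: asboolP => [_|/hL[k [c' hp]]]; first
    by apply: sumr_ge0 => ? _; rewrite sumr_ge0.
  rewrite (bigD1 k) //= (bigD1 c') //= /pth (asboolT hp).
  by rewrite -addrA lerDl addr_ge0 ?sumr_ge0 // => ? _; rewrite sumr_ge0.
apply: le_trans (ler_wpM2r (ler0n _ _) (sum_half_tail s #|I|)).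
rewrite mulr_suml; apply: ler_sum => k _.
apply: (@le_trans _ _ (\sum_(c' : {set I} * {set I}) (2^-1) ^+ (s + k.+1) * weight p c'.1)); last first.
  rewrite -mulr_sumr ler_wpM2l ?exprn_ge0 ?invr_ge0 //.
  have -> : \sum_(c' : {set I} * {set I}) weight p c'.1 =
      \sum_(K : {set I}) \sum_(z : {set I}) weight p K by rewrite pair_bigA.
  under eq_bigr => K _ do rewrite sumr_const card_cube -mulr_natr.
  by rewrite -mulr_suml sum_weight mul1r.
apply: ler_sum => c' _.
apply: (@le_trans _ _ (\sum_(c : {set I} * {set I}) (pth k c c')%:R * 
    ((p / (1 - p)) ^+ (s + k.+1) * weight p c'.1))).
  by apply: ler_sum => c _; rewrite /pth; case: asboolP => [/step ->|_]; rewrite ?mul0r.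
rewrite -mulr_suml -natr_sum -ratio (exprMn _ _ (8 * w)%:R) [leRHS]mulrAC [leLHS]mulrC.
rewrite ler_wpM2l ?mulr_ge0 ?exprn_ge0 ?divr_ge0 ?weight_ge0
  ?free_prob_le1 ?(ltW p0) ?(ltW p1) //.
rewrite -natrX ler_nat; apply: leq_trans (card_walk width _ c').
by rewrite -sum1dep_card [leqRHS]big_mkcond /=; apply: leq_sum => c _; rewrite /pth; case: asbool.
Qed.

Lemma switching b w s f : (0 < w)%N -> certified b w f ->
  \sum_K weight (free_prob w) K *
    avg (fun z => (~~ `[< certified (~~ b) s (restrict f K z) >])%:R)
  <= 2^-1 ^+ s :> R.
Proof.
move=> w0; case: b; first exact: switching_true.
(* A CNF is treated as the negation of a DNF. *)
move=> /certified_neg /(switching_true s w0); apply: le_trans.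
apply: ler_sum => K _; rewrite ler_wpM2l //.
  by rewrite weight_ge0 ?free_prob_le1 // ltW // free_prob_gt0.
apply: le_avg => z; rewrite ler_nat.
case: asboolP => //= h; case: asboolP => //= h'; case: h.
by apply: eq_certified (certified_neg h') => x /=; rewrite /restrict /= negbK.
Qed.

End Switching.

(** * Influence of bounded-depth circuits *)

Section Layered.
Variables (R : realFieldType) (I : finType) (D : nat -> nat) (M : nat).
Implicit Types (A K x y z : {set I}) (F : nat -> {set I} -> bool) (b : bool).

(* [wire_gate] covers OR gates ([b = true]) and AND gates ([b = false]). *)
Inductive wire F k : Prop :=
| wire_input of forall b, certified b 1 (F k)
| wire_not j of (j < k)%N & (D j <= D k)%N & forall x, F k x = ~~ F j x
| wire_gate b s of {in s, forall j, (j < k)%N /\ (D j < D k)%N}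
    & forall x, (F k x == b) = has (fun j => F j x == b) s.

Definition layered F := forall k, (k < M)%N -> wire F k.

(** All wires of depth at most [e] are both DNFs and CNFs of width [w]. *)
Definition narrow F e w := forall k, (k < M)%N -> (D k <= e)%N ->
  forall b, certified b w (F k).

Definition restrict_all F K z k := restrict (F k) K z.

Lemma layered_restrict F K z : layered F -> layered (restrict_all F K z).
Proof.
move=> h k /h[hi|j jk Dj e|b s hs e].
- by apply: wire_input => b; apply: certified_restrict.
- by apply: (wire_not jk Dj) => x; rewrite /restrict_all /restrict e.
- by apply: (wire_gate hs) => x; exact: e.
Qed.

Lemma certified_not b w (f g : {set I} -> bool) : (forall x, f x = ~~ g x) ->
  certified (~~ b) w g -> certified b w f.
Proof.
move=> e /certified_neg; rewrite negbK.
by apply: eq_certified => x /=; rewrite e.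
Qed.

(** Merging an OR into DNFs, or an AND into CNFs, costs no width: a certificate for one input
    certifies the gate. *)
Lemma certified_gate F b k s w : {in s, forall j, certified b w (F j)} ->
  (forall x, (F k x == b) = has (fun j => F j x == b) s) -> certified b w (F k).
Proof.
move=> h e x /eqP; rewrite e => /hasP[j js /eqP /(h j js)[A Aw hA]].
exists A => // y /hA Fy; apply/eqP; rewrite e; apply/hasP.
by exists j; rewrite ?Fy.
Qed.

Lemma certified_const b w (f : {set I} -> bool) :
  (forall x y, f x = f y) -> certified b w f.
Proof.
by move=> h x <-; exists set0 => [|y _]; rewrite ?cards0.
Qed.

Lemma narrow_input F : layered F -> narrow F 0 1.
Proof.
move=> hF; elim/ltn_ind => k IH kM Dk b.
have [hi|j jk Dj e|c s hs e] := hF k kM; first exact: hi.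
- by apply: certified_not e (IH j jk _ _ (~~ b)); [apply: ltn_trans kM|lia].
(* A gate has larger depth than its inputs, so at depth 0 it has none and is constant. *)
- apply: certified_const => x y; case: s hs e => [_ e|j s hs _].
    by move: (e x) (e y) => /= {e}; case: (F k x) (F k y) c => [] [] [].
  by have [_] := hs j (mem_head _ _); lia.
Qed.

(** One level above the narrow wires, merging alone gives a DNF or a CNF, which suffices to bound
    influence; this saves a restriction. *)
Lemma top_certified F e w k : layered F -> (0 < w)%N -> narrow F e w ->
  (k < M)%N -> (D k <= e.+1)%N -> exists b, certified b w (F k).
Proof.
move=> hF w0 hn; elim/ltn_ind: k => k IH kM Dk.
have [hi|j jk Dj eF|c s hs eF] := hF k kM.
- by exists true; apply: certified_le (hi _).
- have [||b hb] := IH j jk; [exact: ltn_trans kM|lia|].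
  by exists (~~ b); apply: certified_not eF _; rewrite negbK.
- exists c; apply: certified_gate eF => j js; have [jk Dj] := hs j js.
  by apply: hn; [apply: ltn_trans kM|lia].
Qed.

(** For a gate at the new level, merging supplies the certificates for one value and switching those
    for the other; negations inherit both from their input. *)
Lemma narrow_restrict F e v w K z : layered F -> (0 < v)%N -> (v <= w)%N ->
  narrow F e v ->
  (forall k b, (k < M)%N -> certified b v (F k) ->
    certified (~~ b) w (restrict (F k) K z)) ->
  narrow (restrict_all F K z) e.+1 w.
Proof.
move=> hF v0 vw hn hs; elim/ltn_ind => k IH kM Dk b.
have [hi|j jk Dj eF|c s hks eF] := hF k kM.
- by apply: certified_restrict; apply: certified_le (hi b); lia.
- apply: (@certified_not _ _ _ (restrict_all F K z j)) => [x|].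
    by rewrite /restrict_all /restrict eF.
  by apply: IH => //; [apply: ltn_trans kM|lia].
- have hc : certified c v (F k).
    apply: certified_gate eF => j js; have [jk Dj] := hks j js.
    by apply: hn; [apply: ltn_trans kM|lia].
  have [->|/negPf bc] := eqVneq b c.
    by apply: certified_restrict; apply: certified_le hc.
  by have -> : b = ~~ c; [case: b c bc {eF hc} => [] [] | exact: hs].
Qed.

(** Union bound of the switching lemma over the [M] wires and the two values of [b]. *)
Lemma prob_not_narrow F e v w : layered F -> (0 < v)%N -> (v <= w)%N ->
  narrow F e v ->
  \sum_K weight (free_prob R v) K *
    avg (fun z => (~~ `[< narrow (restrict_all F K z) e.+1 w >])%:R)
  <= (2 * M)%:R * 2^-1 ^+ w :> R.
Proof.
move=> hF v0 vw hn.
pose bad (k : 'I_M) b K z := `[< certified b v (F k) >] &&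
  ~~ `[< certified (~~ b) w (restrict (F k) K z) >].
have wt0 K : 0 <= weight (free_prob R v) K.
  by rewrite weight_ge0 ?free_prob_le1 ?ltW ?free_prob_gt0.
apply: (@le_trans _ _ (\sum_(k < M) \sum_(b : bool) \sum_K
    weight (free_prob R v) K * avg (fun z => (bad k b K z)%:R))).
  under [leRHS]eq_bigr => k _ do rewrite exchange_big /=.
  rewrite [leRHS]exchange_big /=; apply: ler_sum => K _.
  under [leRHS]eq_bigr => k _ do rewrite -mulr_sumr -avg_sum.
  rewrite -mulr_sumr -avg_sum ler_wpM2l //; apply: le_avg => z.
  case: asboolP => [_|]; first by apply: sumr_ge0 => k _; rewrite sumr_ge0.
  move=> hnn; suff [k [b kb]] : exists k b, bad k b K z.
    rewrite (bigD1 k) //= (bigD1 b) //= kb.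
    by rewrite -addrA lerDl addr_ge0 ?sumr_ge0 // => ? _; rewrite sumr_ge0.
  apply: contra_notP hnn => hnn; apply: (narrow_restrict hF v0 vw hn).
  move=> k b kM hb; apply: contra_notP hnn => hnb; exists (Ordinal kM), b.
  by rewrite /bad (asboolT hb) /=; apply/asboolPn.
have -> : (2 * M)%:R * 2^-1 ^+ w = \sum_(k < M) \sum_(b : bool) 2^-1 ^+ w :> R.
  by rewrite sumr_const card_ord sumr_const card_bool -mulrnA mulr_natl.
apply: ler_sum => k _; apply: ler_sum => b _; rewrite /bad.
case: asboolP => [hb|_] /=; first exact: switching.
rewrite big1 ?exprn_ge0 ?invr_ge0 // => K _.
by rewrite avg_const mulr0.
Qed.

(** The influence is the mean restricted influence divided by the free probability. Good
    restrictions contribute at most [B]; bad ones have influence at most [#|I|] and are rare enough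
    to add at most 1. *)
Lemma influence_step F e v w k (B : R) : layered F ->
  (0 < v)%N -> (v <= w)%N -> narrow F e v -> (k < M)%N ->
  (2 * M * #|I| <= 2 ^ w)%N -> 0 <= B ->
  (forall K z, narrow (restrict_all F K z) e.+1 w ->
    influence R (restrict (F k) K z) <= B) ->
  influence R (F k) <= (1 + 16 * v)%:R * (B + 1).
Proof.
move=> hF v0 vw hn kM large B0 hB.
have p0 := free_prob_gt0 R v; set p := free_prob R v in p0 *.
have -> : (1 + 16 * v)%:R = p^-1 by rewrite /p invrK.
rewrite ler_pdivlMl //; rewrite -influence_restrict.
apply: (@le_trans _ _ (\sum_K (weight p K * B + #|I|%:R * (weight p K *
    avg (fun z => (~~ `[< narrow (restrict_all F K z) e.+1 w >])%:R))))).
  apply: ler_sum => K _.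
  rewrite [X in _ + X]mulrCA -mulrDr.
  rewrite ler_wpM2l ?weight_ge0 ?free_prob_le1 ?(ltW p0) //.
  rewrite -avgZ -[X in X + _](avg_const I) -avgD.
  apply: le_avg => z; case: asboolP => [/hB h|_] /=.
    by rewrite mulr0 addr0.
  by rewrite mulr1 (le_trans (influence_le_card _ _)) // lerDr.
rewrite big_split /= -mulr_suml -mulr_sumr sum_weight mul1r lerD2l.
apply: le_trans (ler_wpM2l (ler0n _ _) (prob_not_narrow hF v0 vw hn)) _.
rewrite mulrA -natrM exprVn ler_pdivrMr ?exprn_gt0 // mul1r -natrX ler_nat.
by rewrite mulnC.
Qed.

(** Each restriction raises the narrow depth by one at the price of a factor [1 + 16 * w <= 17 * w];
    the summand [r] absorbs the additive 1 of every round. *)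
Lemma influence_rounds F e w r k : layered F -> (0 < w)%N ->
  (2 * M * #|I| <= 2 ^ w)%N -> narrow F e w ->
  (k < M)%N -> (D k <= e.+1 + r)%N ->
  influence R (F k) <= ((2 * w + r) * (17 * w) ^ r)%:R.
Proof.
move=> hF w0 large hn kM; elim: r e F hF hn => [|r IH] e F hF hn Dk.
  have [|b] := top_certified hF w0 hn kM; first by rewrite addn0 in Dk.
  by rewrite addn0 expn0 muln1; apply: influence_certified.
apply: le_trans (influence_step (w := w)
  (B := ((2 * w + r) * (17 * w) ^ r)%:R) hF w0 _ hn kM large _ _) _ => //.
  move=> K z hn'; apply: (IH e.+1 (restrict_all F K z)) => //.
    exact: layered_restrict.
  by rewrite addSn -addnS.
rewrite natr1 -natrM ler_nat expnS.
have : (0 < (17 * w) ^ r)%N by rewrite expn_gt0; lia.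
move: (_ ^ _)%N => X X0; nia.
Qed.

(** For positive [d], the first restriction starts from width 1, so it keeps variables free with
    probability [1 / 17] and costs no factor [w]. The later rounds and the final width account for
    [w ^ d]. *)
Lemma influence_layered F w d k : layered F -> (0 < w)%N ->
  (2 * M * #|I| <= 2 ^ w)%N -> (k < M)%N -> (D k <= d.+1)%N ->
  influence R (F k) <= ((d + 2) * (17 * w) ^ d)%:R.
Proof.
move=> hF w0 large kM; have hn := narrow_input hF; case: d => [|d] Dk.
  have [b] := top_certified hF (ltn0Sn 0) hn kM Dk.
  by rewrite expn0 muln1; apply: influence_certified.
apply: le_trans (influence_step (w := w)
  (B := ((2 * w + d) * (17 * w) ^ d)%:R) hF (ltn0Sn 0) _ hn kM large _ _) _ => //.
  by move=> K z hn'; apply: (influence_rounds _ w0 large hn') => //;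
    exact: layered_restrict.
rewrite natr1 -natrM ler_nat expnS.
have : (0 < (17 * w) ^ d)%N by rewrite expn_gt0; lia.
move: (_ ^ _)%N => X X0; nia.
Qed.

End Layered.

(** * Fourier coefficients *)

Section Fourier.
Variables (R : realFieldType) (I : finType).
Implicit Types (S x y : {set I}) (g h : {set I} -> R) (f : {set I} -> bool).

Definition character S x : R := \prod_(i in S) (-1) ^+ (i \in x).

Definition coef g S : R := avg (fun x => g x * character S x).

Definition sign f x : R := (-1) ^+ f x.

Lemma character0 x : character set0 x = 1.
Proof. by rewrite /character big_set0. Qed.

Lemma norm_character S x : `|character S x| = 1.
Proof.
rewrite normr_prod big1 // => i _.
by rewrite normrX normrN1 expr1n.
Qed.

Lemma character_flip S i x :
  character S (flip i x) = (-1) ^+ (i \in S) * character S x.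
Proof.
have E (j : I) : (-1) ^+ (j \in flip i x) = (-1) ^+ (j == i) * (-1) ^+ (j \in x) :> R.
  by rewrite inE signr_addb mulrC.
rewrite /character; under eq_bigr => j _ do rewrite E.
rewrite big_split /=; congr (_ * _).
have [iS|iS] := boolP (i \in S).
  rewrite (bigD1 i) //= eqxx big1 ?mulr1 // => j /andP[_ /negbTE ->].
  by [].
by rewrite big1 // => j jS; case: eqP jS iS => // -> ->.
Qed.

(** The sum factors over coordinates, and a coordinate where [x] and [y] differ gives the factor
    [1 - 1]. *)
Lemma sum_characters x y :
  \sum_S character S x * character S y = (x == y)%:R * (2 ^ #|I|)%:R.
Proof.
pose G i : R := (-1) ^+ (i \in x) * (-1) ^+ (i \in y).
transitivity (\sum_(S in {set I}) \prod_i (if i \in S then G i else 1)).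
  apply: eq_bigr => S _; rewrite -big_split /= [LHS]big_mkcond /=.
  by apply: eq_bigr.
rewrite -(bigA_distr 1 +%R G (fun=> 1)) /=.
have [exy|/eqP xy] := eqVneq x y.
  rewrite mul1r natrX -prodr_const; apply: eq_bigr => i _.
  by rewrite /G exy -signr_addb addbb.
have [i ixy] : exists i, (i \in x) != (i \in y).
  by apply/existsP; apply: contra_notT xy; rewrite negb_exists => /forallP h;
     apply/setP => i; have /negPn/eqP := h i.
rewrite mul0r (bigD1 i) //= /G -signr_addb.
by case: (i \in x) (i \in y) ixy => [] [] //= _; rewrite addNr mul0r.
Qed.

Lemma plancherel g h : \sum_S coef g S * coef h S = avg (fun x => g x * h x).
Proof.
set N : R := (2 ^ #|I|)%:R.
have N0 : N != 0 := cube_neq0 R I.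
transitivity (\sum_S (\sum_x \sum_y g x * h y * (character S x * character S y))
    / N / N).
  apply: eq_bigr => S _; rewrite /coef /avg mulf_div invfM mulrA.
  congr (_ / _ / _); rewrite mulr_suml; apply: eq_bigr => x _.
  rewrite mulr_sumr; apply: eq_bigr => y _; ring.
rewrite -!mulr_suml; congr (_ / _); rewrite exchange_big /= mulr_suml.
apply: eq_bigr => x _; rewrite exchange_big /=.
under eq_bigr => y _ do rewrite -mulr_sumr sum_characters mulrA -/N.
rewrite -mulr_suml mulfK // (bigD1 x) //= eqxx mulr1 big1 ?addr0 // => y.
by rewrite eq_sym => /negbTE ->; rewrite mulr0.
Qed.

Lemma coef_flip g i S : coef (g \o flip i) S = (-1) ^+ (i \in S) * coef g S.
Proof.
rewrite /coef -(avg_flip i) -avgZ; congr avg; apply: funext => x /=.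
by rewrite flipK character_flip mulrCA.
Qed.

Lemma sum_coef_sqr f : \sum_S coef (sign f) S ^+ 2 = 1.
Proof.
under eq_bigr => S _ do rewrite expr2.
rewrite plancherel -[RHS](avg_const I); congr avg; apply: funext => x.
by rewrite /sign -signr_addb addbb.
Qed.

(** The influence of [i] is half of one minus the correlation of [sign f] with its flip; flipping
    negates exactly the coefficients of the sets containing [i], so Plancherel keeps those. *)
Lemma influence_coef f :
  influence R f = \sum_(S : {set I}) #|S|%:R * coef (sign f) S ^+ 2.
Proof.
transitivity (\sum_i 2^-1 * (1 - avg (fun x => sign f x * sign f (flip i x)))).
  rewrite /influence.
  transitivity (avg (fun x => \sum_i (2^-1 + (- 2^-1) * (sign f x * sign f (flip i x))))).
    congr avg; apply: funext => x; rewrite natr_sum; apply: eq_bigr => i _.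
    have -> : (f x != f (flip i x)) = f x (+) f (flip i x) by do 2!case: (f _).
    by rewrite /sign; case: (f x); case: (f (flip i x)) => /=; rewrite ?expr1 ?expr0; field.
  rewrite avg_sum; apply: eq_bigr => i _; rewrite avgD avgZ avg_const.
  by rewrite mulrBr mulr1 mulNr.
transitivity (\sum_i \sum_(S : {set I}) (i \in S)%:R * coef (sign f) S ^+ 2).
  apply: eq_bigr => i _.
  rewrite -(plancherel (sign f) (sign f \o flip i)) -[X in X - _](sum_coef_sqr f).
  rewrite -sumrB mulr_sumr; apply: eq_bigr => S _; rewrite coef_flip.
  by case: (i \in S); rewrite ?expr1 ?expr0 /=; field.
rewrite exchange_big /=; apply: eq_bigr => S _; rewrite -mulr_suml.
by rewrite -natr_sum -sum1_card [in RHS]big_mkcond.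
Qed.

Lemma norm_coef_sign f S : `|coef (sign f) S| <= 1.
Proof.
rewrite /coef /avg normrM normfV normr_nat ler_pdivrMr ?cube_gt0 // mul1r.
apply: le_trans (ler_norm_sum _ _ _) _.
rewrite -(card_cube I) -sum1_card natr_sum; apply: ler_sum => x _.
by rewrite normrM norm_character mulr1 normrX normrN1 expr1n.
Qed.

(** By Markov's inequality at most half of the Fourier weight lies above size [t]; below it, squares
    are bounded by absolute values since coefficients are at most 1. *)
Lemma low_degree_coef f t : 2 * influence R f <= t%:R ->
  2^-1 <= \sum_(S : {set I} | (#|S| <= t)%N) `|coef (sign f) S|.
Proof.
move=> le; apply: (@le_trans _ _ (\sum_(S : {set I} | (#|S| <= t)%N)
    coef (sign f) S ^+ 2)); last first.
  apply: ler_sum => S _; rewrite -real_normK ?num_real // expr2 ler_piMr //.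
  exact: norm_coef_sign.
have := sum_coef_sqr f.
rewrite (bigID (fun S : {set I} => (#|S| <= t)%N)) /=.
set L := \sum_(S | _) _; set H := \sum_(S | _) _ => e.
suff : H * (t%:R + 1) <= influence R f by have := ler0n R t; nra.
rewrite influence_coef [leRHS](bigID (fun S : {set I} => (#|S| <= t)%N)) /=.
rewrite mulr_suml -[leLHS]add0r lerD //.
  by apply: sumr_ge0 => S _; rewrite mulr_ge0 ?sqr_ge0.
apply: ler_sum => S; rewrite -ltnNge => tS.
by rewrite mulrC ler_wpM2r ?sqr_ge0 // natr1 ler_nat.
Qed.

(** A set of size at most [t] is built in [t] rounds, each adding an element or, for [None],
    nothing. *)
Lemma card_small_sets t :
  (#|[set S : {set I} | (#|S| <= t)%N]| <= #|I|.+1 ^ t)%N.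
Proof.
elim: t => [|t IH].
  rewrite expn0 -(cards1 (set0 : {set I})); apply/subset_leq_card/subsetP => S.
  by rewrite !inE leqn0 cards_eq0.
pose g (q : option I * {set I}) := if q.1 is Some i then i |: q.2 else q.2.
apply: leq_trans (_ : #|g @: setX [set: option I]
    [set S : {set I} | (#|S| <= t)%N]| <= _)%N; last first.
  apply: leq_trans (leq_imset_card _ _) _.
  by rewrite cardsX cardsT card_option expnS leq_mul2l IH orbT.
apply/subset_leq_card/subsetP => S; rewrite inE => St; apply/imsetP.
have [->|[i iS]] := set_0Vmem S.
  by exists (None, set0); rewrite // !inE cards0.
exists (Some i, S :\ i); last by rewrite /g /= setD1K.
by rewrite !inE /=; move: St; rewrite (cardsD1 i) iS.
Qed.

End Fourier.

(** * Parity sources *)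

Section Sources.
Variable R : realType.

Definition cube_of n (x : n.-tuple bool) : {set 'I_n} := [set i | tnth x i].
Definition tuple_of n (x : {set 'I_n}) : n.-tuple bool := [tuple i \in x | i < n].

Lemma tuple_ofK n : cancel (@tuple_of n) (@cube_of n).
Proof. by move=> x; apply/setP => i; rewrite inE tnth_mktuple. Qed.

Lemma cube_ofK n : cancel (@cube_of n) (@tuple_of n).
Proof. by move=> x; apply: eq_from_tnth => i; rewrite tnth_mktuple inE. Qed.

Lemma sum_tuple n (g : n.-tuple bool -> R) :
  \sum_x g x = \sum_(x : {set 'I_n}) g (tuple_of x).
Proof.
rewrite (reindex (@tuple_of n)) //; apply: onW_bij.
by exists (@cube_of n); [apply: tuple_ofK | apply: cube_ofK].
Qed.

Lemma SD_test (T : finType) (p q g : T -> R) : (forall a, `|g a| <= 1) ->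
  \sum_a g a * p a - \sum_a g a * q a <= 2 * SD p q.
Proof.
move=> g1; rewrite /SD mulrA divff ?mul1r // -sumrB; apply: ler_sum => a _.
rewrite -mulrBr; apply: le_trans (ler_norm _) _.
by rewrite normrM ler_piMl.
Qed.

Lemma sum_map_pmf (S T : finType) (f : S -> T) (p : S -> R) (g : T -> R) :
  \sum_a g a * map_pmf f p a = \sum_x g (f x) * p x.
Proof.
rewrite [RHS](partition_big f xpredT) //=; apply: eq_bigr => a _.
by rewrite mulr_sumr; apply: eq_bigr => x /eqP ->.
Qed.

(** Strongness lets the test see the seed, so it can correct the sign of the bias seed by seed; this
    puts the absolute value inside the average. *)
Lemma extractor_bias n l m k eps
    (Ext : n.-tuple bool -> l.-tuple bool -> m.-tuple bool) (i : 'I_m)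
    (X : n.-tuple bool -> R) :
  strong_extractor k eps Ext -> is_source k X ->
  (\sum_u `|\sum_x X x * (-1) ^+ tnth (Ext x u) i|) / (2 ^ l)%:R <= 2 * eps.
Proof.
move=> hE hX.
pose bias u : R := \sum_x X x * (-1) ^+ tnth (Ext x u) i.
pose ul (a : (l + m).-tuple bool) : l.-tuple bool := [tuple tnth a (lshift m j) | j < l].
pose g (a : (l + m).-tuple bool) : R :=
  Num.sg (bias (ul a)) * (-1) ^+ tnth a (rshift l i).
have g1 a : `|g a| <= 1.
  by rewrite normrM normrX normrN1 expr1n mulr1 normr_sg; case: (_ != _).
(* Flipping the tested output bit leaves the seed unchanged and negates [g], so [g] has mean 0 under
   the uniform distribution. *)
have g0 : \sum_a g a = 0.
  pose h (a : (l + m).-tuple bool) : (l + m).-tuple bool :=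
    [tuple tnth a j (+) (j == rshift l i) | j < l + m].
  have hK : involutive h.
    move=> a; apply: eq_from_tnth => j; rewrite !tnth_mktuple.
    by rewrite -addbA addbb addbF.
  have : \sum_a g a = - \sum_a g a.
    rewrite {1}(reindex_inj (can_inj hK)) /= -sumrN; apply: eq_bigr => a _.
    rewrite /g -mulrN; congr (Num.sg (bias _) * _).
      apply: eq_from_tnth => j; rewrite !tnth_mktuple.
      by rewrite eq_lrshift addbF.
    by rewrite tnth_mktuple eqxx addbT signrN.
  by lra.
have := le_trans (SD_test _ _ g1) (ler_wpM2l (ler0n _ 2) (hE _ hX)).
rewrite sum_map_pmf /uniform_pmf -mulr_suml g0 mul0r subr0.
apply: le_trans.
rewrite -(pair_bigA _ (fun x u => g (cat_tuple u (Ext x u)) *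
   (X x * #|{: l.-tuple bool}|%:R^-1))) /= exchange_big /= mulr_suml.
apply: ler_sum => u _; rewrite card_tuple card_bool.
have gE x : g (cat_tuple u (Ext x u)) = Num.sg (bias u) * (-1) ^+ tnth (Ext x u) i.
  rewrite /g; congr (Num.sg (bias _) * (-1) ^+ nat_of_bool _).
    by apply: eq_from_tnth => j; rewrite tnth_mktuple tnth_lshift.
  by rewrite tnth_rshift.
under [leRHS]eq_bigr => x _ do rewrite gE mulrA -[_ * X x]mulrA (mulrC (_ ^+ _)).
by rewrite -mulr_suml -mulr_sumr -/(bias u) -normrEsg.
Qed.

Lemma sum_character n (S : {set 'I_n}) : S != set0 ->
  \sum_x character R S x = 0.
Proof.
move=> /set0Pn[i iS].
have : \sum_x character R S x = - \sum_x character R S x.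
  rewrite {1}(reindex_inj (can_inj (@flipK _ i))) /= -sumrN.
  by apply: eq_bigr => x _; rewrite character_flip iS expr1 mulN1r.
by lra.
Qed.

Lemma powR_source n : (0 < n)%N -> 2 `^ (- (n%:R - 1)) = 2 / (2 ^ n)%:R :> R.
Proof.
case: n => // n _; rewrite -(natr1 n) addrK powRN powR_mulrn // natrX exprS.
by rewrite invfM mulrA divff ?mul1r.
Qed.

Lemma uniform_source n : (0 < n)%N ->
  is_source (n%:R - 1) (fun _ : n.-tuple bool => (2 ^ n)%:R^-1 : R).
Proof.
move=> n0; split; first split=> [x|].
- by rewrite invr_ge0.
- by rewrite sumr_const card_tuple card_bool -[_ *+ _]mulr_natr mulVf // pnatr_eq0 expn_eq0.
- by move=> x; rewrite powR_source // ler_peMl ?invr_ge0 // ler1n.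
Qed.

(** The density is that of the uniform distribution on the points of even parity over [S]; it takes
    only the values 0 and [2 / 2 ^ n]. *)
Lemma parity_source n (S : {set 'I_n}) : (0 < n)%N -> S != set0 ->
  is_source (n%:R - 1) (fun x : n.-tuple bool =>
    (1 + character R S (cube_of x)) / (2 ^ n)%:R).
Proof.
move=> n0 S0; have N0 : 0 < (2 ^ n)%:R :> R by rewrite ltr0n expn_gt0.
have ch x : -1 <= character R S x <= 1.
  by rewrite -ler_norml norm_character.
split; first split=> [x|].
- by rewrite divr_ge0 ?(ltW N0) //; have /andP[] := ch (cube_of x); lra.
- rewrite -mulr_suml big_split /= sumr_const card_tuple card_bool.
  rewrite sum_tuple; under eq_bigr => x _ do rewrite tuple_ofK.
  by rewrite sum_character // addr0 mulfV // gt_eqF.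
- move=> x; rewrite powR_source // ler_wpM2r ?invr_ge0 ?(ltW N0) //.
  by have /andP[] := ch (cube_of x); lra.
Qed.

Section Extractor.
Variables (n l m : nat) (eps : R).
Variables (Ext : n.-tuple bool -> l.-tuple bool -> m.-tuple bool) (i : 'I_m).
Hypotheses (n0 : (0 < n)%N) (hE : strong_extractor (n%:R - 1) eps Ext).

Definition output_bit u (x : {set 'I_n}) := tnth (Ext (tuple_of x) u) i.

(** The bias under the parity source is the sum of the coefficients at [set0] and [S], and under the
    uniform source the one at [set0]. Subtracting isolates [S] and adds two errors [2 * eps]. *)
Lemma extractor_coef S :
  \sum_u `|coef (sign R (output_bit u)) S| <= 4 * eps * (2 ^ l)%:R.
Proof.
have N0 : 0 < (2 ^ l)%:R :> R by rewrite ltr0n expn_gt0.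
have E0 u : \sum_x (2 ^ n)%:R^-1 * (-1) ^+ tnth (Ext x u) i =
    coef (sign R (output_bit u)) set0.
  rewrite sum_tuple /coef /avg card_ord mulr_suml; apply: eq_bigr => x _.
  by rewrite character0 mulr1 mulrC.
have h0 : \sum_u `|coef (sign R (output_bit u)) set0| <= 2 * eps * (2 ^ l)%:R.
  rewrite -ler_pdivrMr //.
  apply: le_trans (extractor_bias i hE (uniform_source n0)).
  by rewrite ler_wpM2r ?invr_ge0 //; apply: ler_sum => u _; rewrite E0.
have eps0 : 0 <= 2 * eps * (2 ^ l)%:R.
  by apply: le_trans h0; rewrite sumr_ge0.
have [->|S0] := eqVneq S set0; first by lra.
have ES u : \sum_x (1 + character R S (cube_of x)) / (2 ^ n)%:R *
    (-1) ^+ tnth (Ext x u) i =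
    coef (sign R (output_bit u)) set0 + coef (sign R (output_bit u)) S.
  rewrite sum_tuple /coef -avgD /avg card_ord mulr_suml; apply: eq_bigr => x _.
  by rewrite character0 tuple_ofK mulrAC; congr (_ / _);
    rewrite /sign /output_bit; ring.
have hS : \sum_u `|coef (sign R (output_bit u)) set0
    + coef (sign R (output_bit u)) S| <= 2 * eps * (2 ^ l)%:R.
  rewrite -ler_pdivrMr //.
  apply: le_trans (extractor_bias i hE (parity_source n0 S0)).
  by rewrite ler_wpM2r ?invr_ge0 //; apply: ler_sum => u _; rewrite ES.
rewrite (_ : 4 * eps * _ = 2 * eps * (2 ^ l)%:R + 2 * eps * (2 ^ l)%:R); last ring.
apply: le_trans (lerD hS h0); rewrite -big_split /=; apply: ler_sum => u _.
set c0 := coef _ set0; set cS := coef _ S.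
by have := ler_normB (c0 + cS) c0; rewrite addrAC subrr add0r.
Qed.

(** [Fam] is the same for all seeds, so the sums over seeds and sets can be exchanged and each set
    costs at most [4 * eps] on average. *)
Lemma extractor_error (Fam : {set {set 'I_n}}) :
  (forall u, 2^-1 <= \sum_(S in Fam) `|coef (sign R (output_bit u)) S|) ->
  1 <= 8 * #|Fam|%:R * eps.
Proof.
move=> hF; have N0 : 0 < (2 ^ l)%:R :> R by rewrite ltr0n expn_gt0.
have : \sum_(u : l.-tuple bool) 2^-1 <= \sum_u
    \sum_(S in Fam) `|coef (sign R (output_bit u)) S| by apply: ler_sum.
rewrite sumr_const card_tuple card_bool exchange_big /= => h.
have := le_trans h (ler_sum _ (fun S _ => extractor_coef S)).
rewrite sumr_const -[_ *+ #|_|]mulr_natr -[_ *+ _]mulr_natr => h2.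
by nra.
Qed.

End Extractor.
End Sources.

(** * Wires of a circuit *)

Section Run.
Variables (G T : Type) (t0 : T) (h : seq T -> G -> T).

(** With [gate_val] and [gate_depth] for [h], this is the fold in [circuit_eval] and in
    [circuit_depth]. *)
Definition run v gs := foldl (fun v g => rcons v (h v g)) v gs.

Lemma size_run v gs : size (run v gs) = (size v + size gs)%N.
Proof.
elim: gs v => [|g gs IH] v /=; first by rewrite addn0.
by rewrite /run /= -/(run _ _) IH size_rcons addSnnS.
Qed.

Lemma nth_run_prefix v gs k : (k < size v)%N -> nth t0 (run v gs) k = nth t0 v k.
Proof.
elim: gs v => [|g gs IH] v //= kv.
by rewrite /run /= -/(run _ _) IH ?size_rcons ?ltnS ?(ltnW kv) // nth_rcons kv.
Qed.

Lemma run_take_drop v gs i : run v gs = run (run v (take i gs)) (drop i gs).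
Proof. by rewrite -[in LHS](cat_take_drop i gs) /run foldl_cat. Qed.

Lemma nth_run_take v gs i k : (i <= size gs)%N -> (k < size v + i)%N ->
  nth t0 (run v gs) k = nth t0 (run v (take i gs)) k.
Proof.
by move=> igs ki; rewrite (run_take_drop v gs i) nth_run_prefix // size_run size_takel.
Qed.

Lemma nth_run_gate g0 v gs i : (i < size gs)%N ->
  nth t0 (run v gs) (size v + i) = h (run v (take i gs)) (nth g0 gs i).
Proof.
move=> igs; rewrite (@nth_run_take _ _ i.+1) //; last by rewrite addnS.
rewrite (take_nth g0 igs) -cats1 /run foldl_cat /= -/(run _ _).
by rewrite nth_rcons size_run (size_takel (ltnW igs)) ltnn eqxx.
Qed.

End Run.

Lemma eq_gate_val v v' g :
  {in fanin g, forall j, nth false v j = nth false v' j} ->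
  gate_val v g = gate_val v' g.
Proof.
case: g => [j|s|s] /= h; first by rewrite h // inE.
- exact: eq_in_all.
- exact: eq_in_has.
Qed.

Lemma eq_gate_depth v v' g :
  {in fanin g, forall j, nth 0%N v j = nth 0%N v' j} ->
  gate_depth v g = gate_depth v' g.
Proof.
case: g => [j|s|s] /= h; first by rewrite h // inE.
- by congr _.+1; apply: eq_big_seq.
- by congr _.+1; apply: eq_big_seq.
Qed.

Section Wires.
Variables (n l m : nat) (C : circuit (n + l) m).

Definition wire_depth : nat -> nat :=
  nth 0%N (run gate_depth (nseq (n + l) 0%N) (gates C)).

Definition wire_val (u : l.-tuple bool) (k : nat) (x : {set 'I_n}) : bool :=
  nth false (run gate_val (cat_tuple (tuple_of x) u) (gates C)) k.

Let wires := (n + l + size (gates C))%N.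

(** A gate reads only earlier wires, whose entries no longer change, so it may be evaluated on the
    completed run. *)
Lemma wire_depth_gate i : (i < size (gates C))%N ->
  wire_depth (n + l + i) =
  gate_depth (run gate_depth (nseq (n + l) 0%N) (gates C))
    (nth (GNot 0) (gates C) i).
Proof.
move=> iC; rewrite /wire_depth.
rewrite -[X in (X + i)%N](size_nseq (n + l) 0%N) (nth_run_gate _ _ (GNot 0)) //.
apply: eq_gate_depth => j /(gates_wf iC) ji.
by rewrite [RHS](@nth_run_take _ _ _ _ _ _ i) ?(ltnW iC) // size_nseq.
Qed.

Lemma wire_val_gate u x i : (i < size (gates C))%N ->
  wire_val u (n + l + i) x =
  gate_val (run gate_val (cat_tuple (tuple_of x) u) (gates C))
    (nth (GNot 0) (gates C) i).
Proof.
move=> iC; rewrite /wire_val.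
rewrite -[X in (X + i)%N](size_tuple (cat_tuple (tuple_of x) u)).
rewrite (nth_run_gate _ _ (GNot 0)) //.
apply: eq_gate_val => j /(gates_wf iC) ji.
by rewrite [RHS](@nth_run_take _ _ _ _ _ _ i) ?(ltnW iC) // size_tuple.
Qed.

Lemma wire_val_inl u x (k : 'I_n) : wire_val u k x = (k \in x).
Proof.
rewrite /wire_val nth_run_prefix; last first.
  by rewrite size_tuple (leq_trans (ltn_ord k)) // leq_addr.
by rewrite nth_cat size_tuple ltn_ord -tnth_nth tnth_mktuple.
Qed.

Lemma wire_val_inr u x k : (n <= k < n + l)%N -> wire_val u k x = nth false u (k - n).
Proof.
move=> /andP[nk kl]; rewrite /wire_val nth_run_prefix ?size_tuple //.
by rewrite nth_cat size_tuple ltnNge nk.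
Qed.

Lemma layered_wires u : layered wire_depth wires (wire_val u).
Proof.
move=> k kM; have [kn|nk] := ltnP k n.
  apply: wire_input => b; apply: (@certified_literal _ _ _ (Ordinal kn)) => x y.
  by rewrite -!(wire_val_inl u).
have [kl|lk] := ltnP k (n + l).
  (* Seed wires are constant functions of [x] once [u] is fixed. *)
  by apply: wire_input => b; apply: certified_const => x y; rewrite !wire_val_inr ?nk.
have iC : (k - (n + l) < size (gates C))%N by rewrite ltn_subLR.
have ek : k = (n + l + (k - (n + l)))%N by rewrite subnKC.
have wf := gates_wf iC; have hD := wire_depth_gate iC.
have hV x := wire_val_gate u x iC; rewrite -ek in hD hV wf.
case: (nth _ _ _) wf hD hV => [j|s|s] /= wf hD hV.
- by apply: (@wire_not _ _ _ _ j); rewrite ?hD ?wf // inE.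
(* An AND is false exactly when some input is false. *)
- apply: (@wire_gate _ _ _ _ false s) => [j js|x].
    by rewrite wf // hD ltnS; split=> //; exact: (@leq_bigmax_seq _ s xpredT wire_depth).
  rewrite hV eqbF_neg -has_predC; apply: eq_has => j /=.
  by rewrite eqbF_neg.
- apply: (@wire_gate _ _ _ _ true s) => [j js|x].
    by rewrite wf // hD ltnS; split=> //; exact: (@leq_bigmax_seq _ s xpredT wire_depth).
  by rewrite hV eqb_id; apply: eq_has => j /=; rewrite eqb_id.
Qed.

(** A depth-0 wire is a chain of negations ending at a bit of [x] or of the seed; the seed affects
    only the sign. *)
Lemma depth0_parity (R : realFieldType) k : (k < wires)%N -> wire_depth k = 0%N ->
  exists S, forall u, exists b : bool, forall x,
    sign R (wire_val u k) x = (-1) ^+ b * character R S x.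
Proof.
elim/ltn_ind: k => k IH kM Dk; have [kn|nk] := ltnP k n.
  exists [set Ordinal kn] => u; exists false => x.
  by rewrite /sign /character big_set1 mul1r -(wire_val_inl u).
have [kl|lk] := ltnP k (n + l).
  exists set0 => u; exists (nth false u (k - n)) => x.
  by rewrite /sign character0 mulr1 wire_val_inr ?nk.
have iC : (k - (n + l) < size (gates C))%N by rewrite ltn_subLR.
have ek : k = (n + l + (k - (n + l)))%N by rewrite subnKC.
have wf := gates_wf iC; have hD := wire_depth_gate iC.
have hV u x := wire_val_gate u x iC; rewrite -ek in hD hV wf.
case: (nth _ _ _) wf hD hV => [j|s|s] /= wf hD hV; rewrite ?Dk // in hD.
have jk : (j < k)%N by rewrite wf ?inE.
have [||S hS] := IH j jk; [exact: ltn_trans kM | by rewrite /wire_depth -hD |].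
exists S => u; have [b hb] := hS u; exists (~~ b) => x.
by rewrite signrN mulNr -hb /sign hV -/(wire_val u j x) signrN.
Qed.

End Wires.

(** * Asymptotics *)

Section Asymptotics.
Variable R : realType.

Lemma trunc_log_le_log2 n : (0 < n)%N -> (trunc_log 2 n)%:R <= log2 (n%:R : R).
Proof.
move=> n0; have ln2 : 0 < ln (2 : R) by rewrite ln_gt0 // ltr1n.
rewrite /log2 ler_pdivlMr // mulr_natl -lnXn // ler_ln ?posrE ?exprn_gt0 ?ltr0n //.
by rewrite -natrX ler_nat trunc_logP.
Qed.

Lemma poly_sum_bound n l s c1 c2 : (1 < n)%N ->
  (l <= n ^ c1 + c1)%N -> (s <= n ^ c2 + c2)%N ->
  (2 * (n + l + s) * n <= n ^ (c1 + c2 + 6))%N.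
Proof.
move=> n1 hl hs.
have le c : (c <= n ^ c)%N by apply: ltnW; apply: ltn_expl.
have A1 : (n ^ c1 <= n ^ (c1 + c2))%N by rewrite leq_exp2l // leq_addr.
have A2 : (n ^ c2 <= n ^ (c1 + c2))%N by rewrite leq_exp2l // leq_addl.
have := le c1; have := le c2; rewrite expnD.
move: (n ^ (c1 + c2))%N A1 A2 => X A1 A2 h2 h1.
have X0 : (0 < X)%N by apply: leq_trans A1; rewrite expn_gt0 ltnW.
(* Here [n ^ c1], [c1], [n ^ c2] and [c2] are each at most [X]; the remaining constant 10 is
   absorbed by [n ^ 4]. *)
have B : (2 * (n + l + s) * n <= (n * (5 * X)) * (2 * n))%N by nia.
apply: leq_trans B _.
have : (5 * 2 <= n ^ 4)%N by apply: leq_trans (_ : 2 ^ 4 <= _)%N => //; rewrite leq_exp2r.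
rewrite (_ : n ^ 6 = n ^ 4 * (n * n))%N; last by rewrite !expnS expn0; lia.
by move: (n ^ 4)%N => Y; nia.
Qed.

Lemma leq_exp_trunc_log n c : (n ^ c <= 2 ^ (c * (trunc_log 2 n).+1))%N.
Proof.
rewrite mulnC expnM; case: c => // c.
by rewrite leq_exp2r // ltnW // trunc_log_ltn.
Qed.

(** The 3 comes from [8 = 2 ^ 3] and is absorbed as [log2 n >= 1]. Bounding [n.+1] by [2 ^ k.+1]
    with [k.+1 <= 2 * log2 n] turns 17 into 34 and the factor 2 of [t] into 4. *)
Lemma powR_error_bound d c n (t := (2 * ((d + 2) *
    (17 * (c * (trunc_log 2 n).+1)) ^ d))%N) : (1 < n)%N ->
  (8 * n.+1 ^ t)%:R <= 2 `^ ((3 + 4 * (d + 2)%:R * (34 * c)%:R ^+ d) *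
    log2 (n%:R : R) ^+ d.+1).
Proof.
move=> n1; have := trunc_log_le_log2 (ltnW n1).
move: (log2 _) => L; set k := trunc_log 2 n => kL.
have k1 : (1 <= k)%N by rewrite trunc_log_gt0.
have L1 : 1 <= L by apply: le_trans kL; rewrite ler1n.
apply: (@le_trans _ _ (2 ^+ (3 + t * k.+1))).
  rewrite -natrX ler_nat expnD leq_mul2l /= mulnC expnM.
  case: (t) => // t'; rewrite leq_exp2r //.
  exact: trunc_log_ltn.
rewrite -[2 ^+ _]powR_mulrn //; apply: ler_powR; first by rewrite ler1n.
rewrite natrD natrM.
have kL2 : k.+1%:R <= 2 * L by rewrite -natr1; lra.
have L0 : 0 <= L by lra.
have LX : 1 <= L ^+ d.+1 by rewrite exprn_ege1.
have tL : t%:R <= 2 * (d + 2)%:R * ((34 * c)%:R ^+ d * L ^+ d).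
  rewrite /t mulnA natrM (natrM _ 2) ler_wpM2l ?mulr_ge0 //.
  rewrite natrX -exprMn lerXn2r ?nnegrE ?mulr_ge0 //.
  rewrite mulnA natrM (_ : 34 * c = (17 * c) * 2)%N; last lia.
  by rewrite (natrM _ (17 * c)) -mulrA ler_wpM2l.
rewrite mulrDl lerD //; first by rewrite ler_peMr.
apply: le_trans (ler_pM _ _ tL kL2) _ => //.
by rewrite exprS le_eqVlt; apply/orP; left; apply/eqP; ring.
Qed.

Lemma inv_le_of_error (eps X Y : R) : 0 < X -> 1 <= X * eps -> X <= Y ->
  1 / Y <= eps.
Proof.
move=> X0 hX XY; have Y0 := lt_le_trans X0 XY.
have eps0 : 0 <= eps by nra.
by rewrite ler_pdivrMr // (le_trans hX) // mulrC ler_wpM2l.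
Qed.

End Asymptotics.

(** * The error bound at a single input length *)

Section OneLength.
Variables (R : realType) (n l m : nat) (eps : R) (C : circuit (n + l) m).
Variable Ext : n.-tuple bool -> l.-tuple bool -> m.-tuple bool.
Hypotheses (n0 : (0 < n)%N) (m0 : (0 < m)%N).
Hypothesis hE : strong_extractor (n%:R - 1) eps Ext.
Hypothesis hC : forall x u, circuit_eval C (cat_tuple x u) = Ext x u.

Let bit0 : 'I_m := Ordinal m0.
Let out := tnth (outputs C) bit0.

Lemma output_bitE u : output_bit Ext bit0 u = wire_val C u out.
Proof. by apply: funext => x; rewrite /output_bit -hC tnth_map. Qed.

Lemma out_lt : (out < n + l + circuit_size C)%N.
Proof. by apply: (@outputs_wf _ _ C); rewrite mem_tnth. Qed.

Lemma out_depth : (wire_depth C out <= circuit_depth C)%N.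
Proof.
by apply: (@leq_bigmax_seq _ (outputs C) xpredT (wire_depth C)); rewrite ?mem_tnth.
Qed.

(** The coefficient at one fixed set is 1 in absolute value for every seed, so a singleton family
    suffices. *)
Lemma error_depth0 : circuit_depth C = 0%N -> 1 <= 8 * eps.
Proof.
move=> hd; have := out_depth; rewrite hd leqn0 => /eqP D0.
have [S hS] := depth0_parity R out_lt D0.
suff : 1 <= 8 * #|[set S]|%:R * eps by rewrite cards1 mulr1.
apply: (extractor_error n0 hE (i := bit0)) => u.
rewrite big_set1 output_bitE; have [b hb] := hS u.
suff -> : coef (sign R (wire_val C u out)) S = (-1) ^+ b.
  by rewrite normrX normrN1 expr1n; lra.
rewrite -[RHS](avg_const 'I_n); congr avg; apply: funext => x.
rewrite hb -mulrA -expr2 -real_normK ?num_real //.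
by rewrite norm_character expr1n mulr1.
Qed.

(** The cutoff [t] is twice the influence bound, as the low-degree estimate requires. *)
Lemma error_depthS d w : (circuit_depth C <= d.+1)%N -> (0 < w)%N ->
  (2 * (n + l + circuit_size C) * n <= 2 ^ w)%N ->
  1 <= (8 * n.+1 ^ (2 * ((d + 2) * (17 * w) ^ d)))%:R * eps.
Proof.
move=> hd w0 large; set t := (2 * _)%N.
have h : 1 <= 8 * #|[set S : {set 'I_n} | (#|S| <= t)%N]|%:R * eps.
  apply: (extractor_error n0 hE (i := bit0)) => u.
  rewrite output_bitE (eq_bigl (fun S : {set 'I_n} => (#|S| <= t)%N)).
    apply: low_degree_coef; rewrite /t natrM ler_wpM2l //.
    apply: (influence_layered R (@layered_wires _ _ _ C u) w0).
    - by rewrite card_ord.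
    - exact: out_lt.
    - exact: leq_trans out_depth hd.
  by move=> S; rewrite inE.
apply: (le_trans h); rewrite natrM ler_wpM2r //.
  by have := ler0n R #|[set S : {set 'I_n} | (#|S| <= t)%N]|; nra.
by rewrite ler_wpM2l // ler_nat; have := card_small_sets 'I_n t; rewrite card_ord.
Qed.

End OneLength.

Local Open Scope classical_set_scope.
Local Open Scope ring_scope.

Theorem mainTheorem1 (R : realType) (d : nat) (l m : nat -> nat) (eps : nat -> R)
    (Ext : forall n : nat,
       n.-tuple bool -> (l n).-tuple bool -> (m n).-tuple bool)
    (hl : poly_bounded l)
    (hm : forall n : nat, (0 < n)%N -> (0 < m n)%N)
    (hExt : forall n : nat, (0 < n)%N ->
       strong_extractor (n%:R - 1) (eps n) (Ext n))
    (hAC0 : computed_by_AC0 d Ext) :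
  exists C : R, 0 < C /\
    \forall n \near \oo, 1 / 2 `^ (C * log2 (n%:R : R) ^+ d) <= eps n.
Proof.
have [c1 hl1] := hl; have [C [[c2 hs] hd hev]] := hAC0.
case: d hd {hAC0} => [|d] hd.
  (* In depth 0 the logarithm has exponent 0 and the bound is [1 / 2 ^ 3]. *)
  exists 3; split=> //; exists 1%N => // n /= n1.
  apply: (@inv_le_of_error _ _ 8) => //.
    apply: (error_depth0 n1 (hm n n1) (hExt n n1) (hev n)).
    by apply/eqP; rewrite -leqn0.
  by rewrite expr0 mulr1 (powR_mulrn 3) // -natrX.
(* With this exponent twice the number of wires times [n] is at most [n ^ c], hence at most [2 ^ w]
   for the width [w = c * (trunc_log 2 n).+1]. *)
set c := (c1 + c2 + 6)%N.
exists (3 + 4 * (d + 2)%:R * (34 * c)%:R ^+ d); split.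
  by rewrite ltr_wpDr // mulr_ge0 ?mulr_ge0 ?exprn_ge0.
(* From [n = 2] on, [log2 n] is at least 1. *)
exists 2%N => // n /= n1; have n0 := ltnW n1.
apply: inv_le_of_error (powR_error_bound R d c n1) => //.
apply: (error_depthS n0 (hm n n0) (hExt n n0) (hev n) (hd n)).
  by rewrite muln_gt0 /c addnS.
apply: leq_trans (leq_exp_trunc_log n c).
exact: poly_sum_bound n1 (hl1 n) (hs n).
Qed.
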